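(* For $n\in\mathbb{N}$, $\mathcal{F}_n = n\log 2+O\left(\sqrt{n}\right)$, and hence $\lim_{n\to\infty}\frac{1}{n}\mathcal{F}_n=\log 2$.
   Context: $\mathbb{N}$ denotes the set of positive integers, $\lfloor\cdot\rfloor$ the floor function, and $\log$ the natural logarithm. For $n\in\mathbb{N}$, $\mathcal{F}_n = \#\{k\in\mathbb{Z} : 1\le k\le n,\ \lfloor n/k\rfloor\text{ is odd}\}$. Big O notation: $f(n)=O(g(n))$ means there exist constants $M$ and $a$ such that $|f(n)|\le M g(n)$ for all $n\ge a$. *)

(* Defs.v *)
From mathcomp Require Import all_boot all_order all_algebra.

Set Implicit Arguments.
Unset Strict Implicit.
Unset Printing Implicit Defensive.

Definition odd_floor_count (n : nat) : nat :=
  #|[set k : 'I_n.+1 | (1 <= k)%N && odd (n %/ k)]|.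

(* Main.v *)
(** Writing [odd q] as the alternating sum of [q] signs and exchanging the two
    summations gives F_n = sum_j (-1)^j floor(n / (j+1)). Cut the sum at 2m with
    m = floor(sqrt n). In the head, dropping the floors costs at most 2m, and
    the remaining n times the alternating harmonic sum of length 2m is within
    n / (2m) of n log 2, since that sum is H_2m - H_m and
    1/(x+1) <= log(x+1) - log x <= 1/x. The tail is
    alternating with nonincreasing terms, so it is at most its first term,
    which is at most n / (2m+1). *)

Require Import Defs.
From mathcomp Require Import all_boot all_order all_algebra.
From mathcomp Require Import all_classical all_reals all_analysis.
From mathcomp Require Import ring lra.
Import Order.TTheory GRing.Theory Num.Theory.
Import numFieldNormedType.Exports.

Local Open Scope classical_set_scope.
Local Open Scope ring_scope.

Lemma odd_alternating_sum (R : pzRingType) (q : nat) :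
  (odd q)%:R = \sum_(j < q) (-1) ^+ j :> R.
Proof.
elim: q => [|q IHq]; first by rewrite big_ord0.
rewrite big_ord_recr /= -IHq -signr_odd.
by case: (odd q); rewrite ?expr1 ?expr0 ?subrr ?add0r.
Qed.

Lemma card_multiples (n d : nat) :
  (\sum_(k < n) (d.+1 * k.+1 <= n) = n %/ d.+1)%N.
Proof.
have le_q : (n %/ d.+1 <= n)%N by exact: leq_div.
transitivity (\sum_(k < n | (k < n %/ d.+1)%N) 1)%N.
  rewrite [RHS]big_mkcond; apply: eq_bigr => k _ /=.
  by rewrite mulnC -leq_divRL //; case: leq.
by rewrite -(big_ord_widen _ (fun=> 1%N)) // sum1_card card_ord.
Qed.

(** Both sides count pairs with [j.+1 * k.+1 <= n], signed by [j]. Terms with [j >= n] vanish, so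
    [N] is left free and the sum can be cut at any point. *)
Lemma odd_floor_countE (R : pzRingType) (n N : nat) : (n <= N)%N ->
  (odd_floor_count n)%:R = \sum_(j < N) (-1) ^+ j * (n %/ j.+1)%:R :> R.
Proof.
move=> le_nN.
have -> : odd_floor_count n = (\sum_(k < n) odd (n %/ k.+1))%N.
  rewrite /odd_floor_count -sum1_card big_mkcond big_ord_recl inE /= add0n.
  by apply: eq_bigr => k _; rewrite inE lift0 /=; case: odd.
rewrite natr_sum.
transitivity
    (\sum_(k < n) \sum_(j < N) (-1) ^+ j * ((j.+1 * k.+1 <= n)%N)%:R : R).
  apply: eq_bigr => k _; rewrite odd_alternating_sum.
  have le_q : (n %/ k.+1 <= N)%N by exact: leq_trans (leq_div _ _) le_nN.
  rewrite (big_ord_widen _ (fun j => (-1) ^+ j) le_q) big_mkcond.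
  apply: eq_bigr => j _; rewrite -leq_divRL //.
  by case: leq; rewrite ?mulr1 ?mulr0.
rewrite exchange_big; apply: eq_bigr => j _ /=.
by rewrite -big_distrr -natr_sum card_multiples.
Qed.

(** Peeling off the first term leaves [a 0] minus the alternating sum of the shifted sequence, which
    by induction lies between 0 and [a 1 <= a 0]. *)
Lemma alternating_sum_itv (R : realDomainType) (a : nat -> R) (n : nat) :
  (forall j, 0 <= a j) -> (forall j, a j.+1 <= a j) ->
  0 <= \sum_(j < n) (-1) ^+ j * a j <= a 0%N.
Proof.
elim: n a => [|n IHn] a a_ge0 a_dec; first by rewrite big_ord0 lexx a_ge0.
have /andP[lo hi] := IHn (fun j => a j.+1) (fun j => a_ge0 _) (fun j => a_dec _).
rewrite big_ord_recl expr0 mul1r.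
under eq_bigr => j _ do rewrite /= /bump /= add1n exprS mulN1r mulNr.
by rewrite sumrN; have := a_dec 0%N; move: lo hi => /=; lra.
Qed.

Section Ln2.
Variable R : realType.

Let harmonic_sum (n : nat) : R := \sum_(j < n) j.+1%:R^-1.

Let harmonic_sumS (n : nat) : harmonic_sum n.+1 = harmonic_sum n + n.+1%:R^-1.
Proof. exact: big_ord_recr. Qed.

(** Both bounds are [ln (1 + t) <= t], taken at [t = 1/x] and at [t = -1/(x+1)]. *)
Lemma ln_add1_bounds (x : R) : 0 < x ->
  (x + 1)^-1 <= ln (x + 1) - ln x <= x^-1.
Proof.
move=> x0; have x1 : 0 < x + 1 by lra.
have i1 : (x + 1)^-1 < 1 by rewrite invf_lt1 //; lra.
have i0 : 0 < x^-1 by rewrite invr_gt0.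
have upper : ln (1 + x^-1) <= x^-1 by apply: le_ln1Dx; lra.
have lower : ln (1 - (x + 1)^-1) <= - (x + 1)^-1.
  by apply: le_ln1Dx; rewrite ltrN2.
move: upper lower.
have -> : 1 + x^-1 = (x + 1) / x by field; rewrite lt0r_neq0.
have -> : 1 - (x + 1)^-1 = x / (x + 1) by field; rewrite lt0r_neq0.
by rewrite !ln_div ?posrE // => upper lower; apply/andP; split=> //; lra.
Qed.

(** Telescoping over [x = k, ..., k+d-1]: the upper sum is the lower one shifted by one index, so it
    gains [1/k] and loses [1/(k+d)]. *)
Lemma ln_harmonic_bounds (k d : nat) : (0 < k)%N ->
  harmonic_sum (k + d) - harmonic_sum k <= ln (k + d)%:R - ln k%:R
  <= harmonic_sum (k + d) - harmonic_sum k + k%:R^-1 - (k + d)%:R^-1.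
Proof.
move=> k_gt0; elim: d => [|d IHd]; first by rewrite addn0; lra.
have kd_gt0 : 0 < (k + d)%:R :> R by rewrite ltr0n addn_gt0 k_gt0.
have := ln_add1_bounds _ kd_gt0; move: IHd.
rewrite natr1 addnS harmonic_sumS.
move: (k + d)%N (k + d).+1 => p q /andP[? ?] /andP[? ?].
by apply/andP; split; lra.
Qed.

(** The negative terms are those with even denominators; removing them twice from the full sum
    removes [2 * (1/2)] times the harmonic sum of length [k]. *)
Lemma alternating_harmonic_sumE (k : nat) :
  \sum_(j < k.*2) (-1) ^+ j / j.+1%:R = harmonic_sum k.*2 - harmonic_sum k.
Proof.
elim: k => [|k IHk]; first by rewrite double0 big_ord0 subrr.
rewrite doubleS !big_ord_recr /= IHk !harmonic_sumS.
rewrite exprS -signr_odd odd_double expr0 -doubleS -[k.+1.*2]mul2n natrM.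
have : k.+1%:R != 0 :> R by rewrite pnatr_eq0.
have : k.*2.+1%:R != 0 :> R by rewrite pnatr_eq0.
by move=> ? ?; field; apply/andP.
Qed.

Lemma alternating_harmonic_ln2 (k : nat) : (0 < k)%N ->
  `|\sum_(j < k.*2) (-1) ^+ j / j.+1%:R - ln 2 : R| <= k.*2%:R^-1.
Proof.
(* With [d = k] the logarithms differ by [ln 2], and the gap [1/k - 1/(2k)] is [1/(2k)]. *)
move=> k_gt0; have := ln_harmonic_bounds k k k_gt0.
rewrite addnn -alternating_harmonic_sumE -mul2n natrM mul2n.
have k0 : 0 < k%:R :> R by rewrite ltr0n.
rewrite lnM ?posrE // addrK.
have -> : (2 * k%:R)^-1 = k%:R^-1 / 2 :> R by field; rewrite lt0r_neq0.
by rewrite ler_norml; lra.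
Qed.

End Ln2.

Lemma natr_div_bounds (R : realFieldType) (n d : nat) :
  (n %/ d.+1)%:R <= (n%:R / d.+1%:R : R) <= (n %/ d.+1)%:R + 1.
Proof.
rewrite ler_pdivlMr ?ltr0n // ler_pdivrMr ?ltr0n // natr1 -!natrM !ler_nat.
by rewrite leq_divM ltnW // ltn_ceil.
Qed.

(** The 6 collects three errors (tail, floors, logarithm), each at most [2m <= 2 * sqrt n]. *)
Lemma odd_floor_count_ln2_bound (R : realType) (n : nat) :
  `|(odd_floor_count n)%:R - n%:R * ln 2| <= 6 * Num.sqrt n%:R :> R.
Proof.
case: (posnP n) => [->|n_gt0].
  by rewrite (odd_floor_countE R 0 0) // big_ord0 mul0r subrr normr0 sqrtr0 mulr0.
set s : R := Num.sqrt n%:R.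
have sE : s ^+ 2 = n%:R by rewrite sqr_sqrtr.
have s1 : 1 <= s by rewrite -sqrtr1 ler_wsqrtr // ler1n.
pose m := Num.truncn s.
have /andP[ms sm] : m%:R <= s < m.+1%:R by apply: truncn_itv; lra.
have m_gt0 : (0 < m)%N by rewrite -(ltr_nat R); move: sm; rewrite -natr1; lra.
have m1 : 1 <= m%:R :> R by rewrite ler1n.
have mE : m.*2%:R = 2 * m%:R :> R by rewrite -mul2n natrM.
(* From [s < m + 1 <= 2m]; this turns both [n/(2m)] and [n/(2m+1)] into at most [2m]. *)
have le_nm : n%:R <= 4 * m%:R ^+ 2 :> R.
  by rewrite -sE; move: sm; rewrite -natr1; nra.
(* Length [2m + n] rather than [n], since [2m] exceeds [n] when [n = 1]. *)
rewrite (odd_floor_countE R n (m.*2 + n)) ?leq_addl // big_split_ord /=.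
set head := \sum_(j < m.*2) _; set tail := \sum_(j < n) _.
have tail_le : `|tail| <= 2 * m%:R.
  have -> : tail = \sum_(j < n) (-1) ^+ j * (n %/ (m.*2 + j).+1)%:R.
    apply: eq_bigr => j _.
    by rewrite exprD -[(-1) ^+ m.*2]signr_odd odd_double mul1r.
  have := alternating_sum_itv R (fun j => (n %/ (m.*2 + j).+1)%:R) n.
  move=> /(_ (fun j => ler0n _ _)) /(_ _)/andP[].
    by move=> j; rewrite ler_nat leq_div2l // addnS.
  move=> lo hi; rewrite ger0_norm //; apply: le_trans hi _; rewrite addn0.
  have /andP[+ _] := natr_div_bounds R n m.*2; move=> /le_trans; apply.
  by rewrite ler_pdivrMr ?ltr0n // -[m.*2.+1%:R]natr1 mE; nra.
have head_le : `|head - n%:R * \sum_(j < m.*2) (-1) ^+ j / j.+1%:R| <= 2 * m%:R.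
  rewrite mulr_sumr -sumrB -mE; apply: le_trans (ler_norm_sum _ _ _) _.
  rewrite -[leRHS]mulr1n -[in leRHS](card_ord m.*2).
  rewrite -sum1_card natr_sum ler_sum // => j _.
  rewrite mulrCA -mulrBr normrM normrX normrN1 expr1n mul1r.
  have := natr_div_bounds R n j; move: (n%:R / _) => x.
  by rewrite ler_norml; lra.
have ln2_le :
    `|n%:R * (\sum_(j < m.*2) (-1) ^+ j / j.+1%:R - ln 2) : R| <= 2 * m%:R.
  rewrite normrM ger0_norm //.
  have := alternating_harmonic_ln2 R m m_gt0.
  move=> /(ler_wpM2l (ler0n R n)) /le_trans; apply.
  by rewrite ler_pdivrMr mE; nra.
move: tail_le head_le ln2_le; rewrite mulrBr.
by rewrite !ler_norml; lra.
Qed.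

Theorem proposition2p6 (R : realType) :
  (fun n : nat => (odd_floor_count n)%:R : R)
     = (fun n : nat => n%:R * ln 2) +O_\oo (fun n : nat => Num.sqrt (n%:R : R))
  /\ n%:R^-1 * (odd_floor_count n)%:R @[n --> \oo] --> (ln 2 : R).
Proof.
split.
  apply/eqaddOP; exists 6; split; first exact: num_real.
  move=> k k6; apply: filterE => n /=.
  apply: le_trans (odd_floor_count_ln2_bound R n) _.
  by rewrite ger0_norm ?sqrtr_ge0 // ler_wpM2r ?sqrtr_ge0 // ltW.
apply/cvgrPdistC_le => e e_gt0; near=> n.
have n_gt0 : 0 < n%:R :> R by rewrite ltr0n; near: n; exact: nbhs_infty_gt.
(* This threshold gives [6 <= e * sqrt n], hence [6 * sqrt n <= e * n]. *)
have n_large : (6 / e) ^+ 2 <= n%:R by near: n; exact: nbhs_infty_ger.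
have s_gt0 : 0 < Num.sqrt n%:R :> R by rewrite sqrtr_gt0.
have es : 6 <= e * Num.sqrt n%:R.
  rewrite mulrC -ler_pdivrMr //; have ? : 0 <= 6 / e by rewrite divr_ge0 ?ltW.
  by rewrite -ler_sqr ?nnegrE ?sqrtr_ge0 // sqr_sqrtr.
have -> : n%:R^-1 * (odd_floor_count n)%:R - ln 2 =
    n%:R^-1 * ((odd_floor_count n)%:R - n%:R * ln 2) :> R.
  by field; rewrite lt0r_neq0.
rewrite normrM ger0_norm ?invr_ge0 // mulrC ler_pdivrMr //.
apply: le_trans (odd_floor_count_ln2_bound R n) _.
have := sqr_sqrtr (ler0n R n); nra.
Unshelve. all: by end_near.
Qed.
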